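(* Let $n\geq 3$ and let $C_n$ be the cycle on $n$ vertices. For every integer $r$ with $1\leq r\leq \lfloor \frac{n}{2}\rfloor$, the $r$-th power $C_n^r$ of $C_n$ satisfies $cn(C_n^r)=cn(C_n)$.
   Context: The $r$-th power $G^r$ of a simple graph $G$ is the graph with the same vertex set as $G$, two distinct vertices being adjacent in $G^r$ if and only if their distance in $G$ is at most $r$. The curling number of a finite nonempty sequence $S$ of integers is the largest $k$ such that $S$ can be written as a concatenation $XY^k$ with $Y$ a nonempty sequence ($X$ possibly empty). The degree sequence of a finite graph $G$ may be rearranged in any order, and the curling number $cn(G)$ is the largest curling number over all arrangements of the degree sequence; grouping equal degrees together into constant blocks, $cn(G)$ is the largest number of vertices of $G$ having a common degree. *)

(* Defs.v *)
From mathcomp Require Import all_boot.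

Set Implicit Arguments.
Unset Strict Implicit.
Unset Printing Implicit Defensive.

Record sgraph := SGraph {
  vertex :> finType;
  adj : rel vertex;
  adj_sym : symmetric adj;
  adj_irr : irreflexive adj
}.

Definition walk (G : sgraph) (k : nat) (x y : G) : bool :=
  [exists p : k.-tuple G, path (@adj G) x p && (last x p == y)].

(* A shortest walk has fewer than #|G| edges, so searching the lengths below
   #|G| suffices (see distP); None is the infinite distance. *)
Definition dist (G : sgraph) (x y : G) : option nat :=
  let d := find (fun k => walk k x y) (iota 0 #|G|) in
  if d < #|G| then Some d else None.

Lemma walkP (G : sgraph) k (x y : G) :
  reflect (exists p : seq G, [/\ path (@adj G) x p, last x p = y & size p = k])
          (walk k x y).
Proof.
apply: (iffP existsP) => [[p /andP[pp /eqP lp]]|[p [pp lp sp]]].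
  by exists p; rewrite size_tuple.
by exists (tcast sp (in_tuple p)); rewrite val_tcast pp lp eqxx.
Qed.

Lemma walk_short (G : sgraph) k (x y : G) :
  walk k x y -> exists2 j, j <= k & (j < #|G|) && walk j x y.
Proof.
case/walkP=> p [pp lp <-]; case/shortenP: pp lp => q pq uq sq lq.
exists (size q).
  by apply: uniq_leq_size sq; case/andP: uq.
apply/andP; split; last by apply/walkP; exists q.
by rewrite -[_.+1]/(size (x :: q)) -(card_uniqP uq) max_card.
Qed.

Lemma distP (G : sgraph) (x y : G) :
  match dist x y with
  | Some d => walk d x y /\ (forall k, walk k x y -> d <= k)
  | None => forall k, ~~ walk k x y
  end.
Proof.
rewrite /dist; case: ifP => [lt_d|ge_d].
  set a := fun k => walk k x y in lt_d *.
  have ha : has a (iota 0 #|G|) by rewrite has_find size_iota.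
  split; first by have := nth_find 0 ha; rewrite nth_iota.
  move=> k /walk_short[j le_jk /andP[lt_j wj]]; apply: leq_trans le_jk.
  rewrite leqNgt; apply/negP => /(before_find 0).
  by rewrite nth_iota // add0n /a wj.
move=> k; apply/negP => /walk_short[j _ /andP[lt_j wj]].
suff: has (fun k => walk k x y) (iota 0 #|G|) by rewrite has_find size_iota ge_d.
by apply/hasP; exists j; rewrite // mem_iota.
Qed.

Lemma walk_sym (G : sgraph) k (x y : G) : walk k x y = walk k y x.
Proof.
wlog suff: x y / walk k x y -> walk k y x by move=> H; apply/idP/idP; apply: H.
case/walkP=> p [pp lp sp]; apply/walkP; exists (rev (belast x p)).
split; last by rewrite size_rev size_belast.
  by rewrite -lp rev_path (eq_path (e' := @adj G)) // => u v; apply: adj_sym.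
by case: p pp lp sp => //= z p _ _ _; rewrite rev_cons last_rcons.
Qed.

Lemma dist_sym (G : sgraph) (x y : G) : dist x y = dist y x.
Proof. by rewrite /dist (eq_find (a2 := fun k => walk k y x)) // => k; apply: walk_sym. Qed.

Definition gpow_adj (G : sgraph) (r : nat) : rel G := fun x y =>
  (x != y) && (if dist x y is Some d then d <= r else false).

Lemma gpow_sym (G : sgraph) r : symmetric (@gpow_adj G r).
Proof. by move=> x y; rewrite /gpow_adj eq_sym dist_sym. Qed.

Lemma gpow_irr (G : sgraph) r : irreflexive (@gpow_adj G r).
Proof. by move=> x; rewrite /gpow_adj eqxx. Qed.

Definition gpow (G : sgraph) (r : nat) : sgraph :=
  SGraph (@gpow_sym G r) (@gpow_irr G r).

(* ordS i is i + 1 modulo n. For n >= 3 the condition i != j is redundant; it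
   only removes the loop in the degenerate case n = 1. *)
Definition cycle_adj (n : nat) : rel 'I_n := fun i j =>
  (i != j) && ((j == ordS i) || (i == ordS j)).

Lemma cycle_sym n : symmetric (@cycle_adj n).
Proof. by move=> i j; rewrite /cycle_adj eq_sym orbC. Qed.

Lemma cycle_irr n : irreflexive (@cycle_adj n).
Proof. by move=> i; rewrite /cycle_adj eqxx. Qed.

Definition cycle_graph (n : nat) : sgraph := SGraph (@cycle_sym n) (@cycle_irr n).

Definition degree (G : sgraph) (x : G) : nat := #|[set y | adj x y]|.

Definition degree_seq (G : sgraph) : seq nat := [seq degree x | x <- enum G].

(* s = X ++ Y^k with Y nonempty, X being the prefix of length i and Y the block
   of length m that follows it (see curlsP). *)
Definition curls (T : eqType) (s : seq T) (k : nat) : bool :=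
  [exists i : 'I_(size s).+1, exists m : 'I_(size s).+1,
    let X := take i s in let Y := take m (drop i s) in
    (Y != [::]) && (s == X ++ flatten (nseq k Y))].

(* Y being nonempty, k is at most the length of s. *)
Definition curling_number (T : eqType) (s : seq T) : nat :=
  \max_(k < (size s).+1 | curls s k) k.

Lemma curlsP (T : eqType) (s : seq T) k : 0 < k ->
  reflect (exists X Y : seq T, Y <> [::] /\ s = X ++ flatten (nseq k Y))
          (curls s k).
Proof.
case: k => // k _; apply: (iffP existsP).
  case=> i /existsP[m /andP[/eqP Y0 /eqP es]].
  by exists (take i s), (take m (drop i s)).
case=> X [Y [Y0 es]].
have lX : size X < (size s).+1 by rewrite ltnS es size_cat leq_addr.
have lY : size Y < (size s).+1.
  by rewrite ltnS es /= !size_cat addnCA leq_addr.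
exists (Ordinal lX); apply/existsP; exists (Ordinal lY) => /=.
have -> : take (size X) s = X by rewrite es take_size_cat.
have -> : take (size Y) (drop (size X) s) = Y.
  by rewrite es drop_size_cat //= take_size_cat.
by apply/andP; split; [apply/eqP | rewrite {1}es].
Qed.

Lemma curling_numberP (T : eqType) (s : seq T) : s <> [::] ->
  curls s (curling_number s) /\ (forall k, curls s k -> k <= curling_number s).
Proof.
move=> s0; have c1 : curls s 1.
  by apply/curlsP => //; exists [::], s; rewrite /= cats0.
have b k : curls s k -> k < (size s).+1.
  case: k => // k /curlsP[] // X [Y [/eqP Y0 es]]; rewrite ltnS es size_cat.
  rewrite size_flatten /shape map_nseq sumn_nseq -size_eq0 -lt0n in Y0 *.
  by apply: leq_trans (leq_addl _ _); rewrite leq_pmull.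
split; last first.
  by move=> k ck; apply: (bigmax_sup (Ordinal (b k ck))).
pose i1 := Ordinal (b 1 c1).
have h : 0 < #|[pred k : 'I_(size s).+1 | curls s k]|.
  by apply/card_gt0P; exists i1.
by rewrite /curling_number; have [i ci ->] := eq_bigmax_cond (fun k : 'I__ => val k) h.
Qed.

Definition cn (G : sgraph) : nat :=
  \max_(t <- permutations (degree_seq G)) curling_number t.

(* Main.v *)
(** Powers of a graph inherit its automorphisms, so [C_n^r] has the rotation of
    [C_n] as an automorphism and both graphs are regular on [n] vertices. The
    degree sequence of a regular graph is constant, whence its curling number is
    its number of vertices. *)

Require Import Defs.
From mathcomp Require Import all_boot.

Set Implicit Arguments.
Unset Strict Implicit.
Unset Printing Implicit Defensive.

Section Automorphism.

Variables (G : sgraph) (f : G -> G).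
Hypotheses (f_inj : injective f) (f_adj : {mono f : x y / adj x y}).

(** On a finite vertex set [f] is bijective, so walks are carried forward by [f] and back by its
    inverse [g]. *)
Lemma walk_aut k : {mono f : x y / walk k x y}.
Proof.
move=> x y; have [g fK gK] := injF_bij f_inj.
apply/walkP/walkP => -[p [pp lp sp]]; last first.
  by exists (map f p); rewrite last_map lp size_map (mono_path f_adj).
exists (map g p); split; last by rewrite size_map.
  by rewrite -(mono_path f_adj) -map_comp (eq_map gK) map_id.
by apply: f_inj; rewrite -last_map -map_comp (eq_map gK) map_id.
Qed.

Lemma gpow_aut r : {mono f : x y / adj (s := gpow G r) x y}.
Proof.
move=> x y; rewrite /= /gpow_adj (inj_eq f_inj) /dist.
by rewrite (eq_find (a2 := fun k => walk k x y)) // => k; apply: walk_aut.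
Qed.

(** The neighbours of [f x] are the image under [f] of those of [x]. *)
Lemma degree_aut x : degree (f x) = degree x.
Proof.
rewrite /degree -[RHS](card_imset _ f_inj); apply: eq_card => y.
have [g fK gK] := injF_bij f_inj.
by rewrite -[y]gK (mem_imset _ _ f_inj) !inE f_adj.
Qed.

End Automorphism.

Lemma curling_number_nseq (T : eqType) n (x : T) : curling_number (nseq n x) = n.
Proof.
apply/eqP; rewrite eqn_leq; apply/andP; split.
  (* The index of the maximum already ranges only up to the length. *)
  by apply/bigmax_leqP => k _; rewrite -ltnS -[X in _ < X.+1](size_nseq n x).
case: n => // n; have [//|_ le_cn] := @curling_numberP _ (nseq n.+1 x).
(* Empty prefix and a one-letter block attain the bound. *)
apply: le_cn; apply/curlsP => //; exists [::], [:: x]; split=> //=.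
by congr (_ :: _); elim: n => //= n <-.
Qed.

(** A constant sequence has no arrangement but itself. *)
Lemma cn_regular (G : sgraph) d : (forall x : G, degree x = d) -> cn G = #|G|.
Proof.
move=> deg_d.
have eG : degree_seq G = nseq #|G| d.
  by rewrite /degree_seq (eq_map deg_d) cardE; elim: (enum G) => //= x s ->.
have perm_nseq t : t \in permutations (degree_seq G) -> t = nseq #|G| d.
  rewrite mem_permutations eG => pt.
  have /all_pred1P -> : all (pred1 d) t by rewrite (perm_all _ pt) all_pred1_nseq.
  by rewrite (perm_size pt) size_nseq.
apply/eqP; rewrite eqn_leq; apply/andP; split.
  by apply/bigmax_leqP_seq => t /perm_nseq-> _; rewrite curling_number_nseq.
apply: (bigmaxn_sup_seq (degree_seq G)) => //.
  by rewrite mem_permutations.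
by rewrite eG curling_number_nseq.
Qed.

Lemma cycle_adj_ordS n : {mono @ordS n : i j / cycle_adj i j}.
Proof. by move=> i j; rewrite /cycle_adj !(inj_eq (@ordS_inj n)). Qed.

(** The rotation is transitive: every index is reached from 0 by successors, without wrapping
    around. *)
Lemma ordS_invariant (T : Type) n (F : 'I_n.+1 -> T) :
  (forall i, F (ordS i) = F i) -> forall i, F i = F ord0.
Proof.
move=> FS [i]; elim: i => [|i IHi] lt_i; first by congr F; apply: val_inj.
rewrite -(IHi (ltnW lt_i)) -[RHS]FS; congr F; apply: val_inj.
by rewrite /= modn_small.
Qed.

Lemma cn_circulant n (e : rel 'I_n.+1) (e_sym : symmetric e)
    (e_irr : irreflexive e) :
  {mono @ordS n.+1 : i j / e i j} -> cn (SGraph e_sym e_irr) = n.+1.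
Proof.
set G := SGraph _ _ => eS; rewrite -[RHS]card_ord.
apply: (@cn_regular G (degree (ord0 : G))); apply: ordS_invariant.
exact: (@degree_aut G (@ordS n.+1) (@ordS_inj n.+1) eS).
Qed.

Theorem proposition2p5 (n r : nat) (hn : 3 <= n) (hr1 : 1 <= r)
    (hr2 : r <= n %/ 2) :
  cn (gpow (cycle_graph n) r) = cn (cycle_graph n).
Proof.
case: n hn hr2 => // n _ _.
(* Both sides become [n.+1]; rotation invariance remains to be checked, first for the cycle, then
   for its power. *)
rewrite !cn_circulant //; first exact: cycle_adj_ordS.
exact: (@gpow_aut (cycle_graph n.+1) _ (@ordS_inj n.+1) (@cycle_adj_ordS n.+1)).
Qed.
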